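(* For an arbitrary $w\in\mathbb{F}$ with $|w|>1$, the unbounded linear weighted backward shift operator \[ A_wx:=(w^kx_{k+1})_{k\in\mathbb{N}} \] in the space $(X,\|\cdot\|)$ with maximal domain \[ D(A_w):=\{x:=(x_k)_{k\in\mathbb{N}}\in X\mid (w^kx_{k+1})_{k\in\mathbb{N}}\in X\} \] is chaotic as well as its every power $A_w^n$, $n\in\mathbb{N}$. Furthermore, each $\lambda\in\mathbb{F}$ is an eigenvalue for $A_w$ of geometric multiplicity $1$, i.e., \[ \dim\ker(A_w-\lambda I)=1. \] In particular, provided the space $(X,\|\cdot\|)$ is complex (i.e., $\mathbb{F}=\mathbb{C}$), $\sigma_p(A_w)=\mathbb{C}$.
   Context: $\mathbb{F}:=\mathbb{R}$ or $\mathbb{F}:=\mathbb{C}$; $\mathbb{N}=\{1,2,3,\dots\}$, $\mathbb{Z}_+=\{0,1,2,\dots\}$. $X$ is the separable infinite-dimensional Banach space over $\mathbb{F}$ \[ X:=\Big\{(x_k)_{k\in\mathbb{N}}\in\mathbb{F}^{\mathbb{N}}\ \Big|\ \sum_{k=1}^\infty\Big|\frac{x_{k+1}}{k+1}-\frac{x_k}{k}\Big|<\infty\ \text{and}\ \lim_{k\to\infty}\frac{x_k}{k}=0\Big\} \] with the norm $\|x\|:=\sum_{k=1}^\infty\left|\frac{x_{k+1}}{k+1}-\frac{x_k}{k}\right|$. For a (bounded or unbounded) linear operator $A$ in a (real or complex) Banach space $E$ with domain $D(A)$, powers $A^n$ have their natural domains ($D(A^{n+1})=\{x\in D(A^n)\mid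 A^nx\in D(A)\}$), $A^0:=I$, and $C^\infty(A):=\bigcap_{n=0}^\infty D(A^n)$. A nonzero vector $x\in C^\infty(A)$ is hypercyclic for $A$ if its orbit $\{A^nx\}_{n\in\mathbb{Z}_+}$ is dense in $E$; $A$ is hypercyclic if it has a hypercyclic vector. A vector $x\in D(A^N)$ with $A^Nx=x$ for some $N\in\mathbb{N}$ is a periodic point of $A$. $A$ is chaotic if it is hypercyclic and its set of periodic points is dense in $E$. For a closed linear operator $A$ in a complex Banach space, the point spectrum $\sigma_p(A)$ is the set of $\lambda\in\mathbb{C}$ for which $A-\lambda I$ is not injective (the eigenvalues of $A$). *)

(* Defs.v *)
From HB Require Import structures.
From mathcomp Require Import all_boot all_order all_algebra.
From mathcomp Require Import complex.
From mathcomp Require Import all_classical all_reals.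
From mathcomp Require Import topology normedtype sequences.

Set Implicit Arguments.
Unset Strict Implicit.
Unset Printing Implicit Defensive.

Import Order.TTheory GRing.Theory Num.Theory.
Import numFieldNormedType.Exports.

Local Open Scope classical_set_scope.
Local Open Scope ring_scope.

(* R is the field of real numbers; over R[i] moduli and norms take values in
   R[i], where 0 <= z means that z is a nonnegative real. *)
Variant scalars := RealScalars | ComplexScalars.

Definition scalar_field (R : realType) (s : scalars) : numFieldType :=
  match s with RealScalars => R | ComplexScalars => R[i] end.

Section Operators.
Variables (K : numFieldType) (V : lmodType K).

(* The values of [op] outside [dom] are irrelevant. *)
Record operator := Operator {
  dom : set V;
  op :> V -> V;
  dom0 : dom 0;
  domP : forall (a : K) x y, dom x -> dom y -> dom (a *: x + y);
  opP : forall (a : K) x y, dom x -> dom y ->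
    op (a *: x + y) = a *: op x + op y
}.

Fixpoint pow_dom (A : operator) (n : nat) : set V :=
  if n is m.+1 then [set x | pow_dom A m x /\ dom A (iter m A x)] else setT.

Lemma pow_dom_linear A n (a : K) x y : pow_dom A n x -> pow_dom A n y ->
  pow_dom A n (a *: x + y) /\
  iter n A (a *: x + y) = a *: iter n A x + iter n A y.
Proof.
elim: n => //= n IHn [Dx Ax] [Dy Ay]; have [D E] := IHn Dx Dy.
by rewrite E; split; [split=> //; exact: domP | exact: opP].
Qed.

Lemma pow_dom0 A n : pow_dom A n 0.
Proof.
suff: pow_dom A n 0 /\ iter n A 0 = 0 by case.
have A0 : A 0 = 0.
  have := @opP A (-1) 0 0 (dom0 A) (dom0 A).
  by rewrite scaler0 add0r scaleN1r addNr.
elim: n => //= n [D E]; rewrite E; split=> //; split=> //; exact: dom0.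
Qed.

Definition pow_operator (A : operator) (n : nat) : operator :=
  @Operator (pow_dom A n) (iter n A) (pow_dom0 A n)
    (fun a x y Dx Dy => (pow_dom_linear a Dx Dy).1)
    (fun a x y Dx Dy => (pow_dom_linear a Dx Dy).2).

Lemma sub_scalar_linear (A : operator) (l a : K) x y : dom A x -> dom A y ->
  A (a *: x + y) - l *: (a *: x + y) =
  a *: (A x - l *: x) + (A y - l *: y).
Proof.
move=> Dx Dy; rewrite opP// scalerBr scalerDr !scalerA (mulrC l) opprD.
by rewrite addrACA.
Qed.

Definition sub_scalar (A : operator) (l : K) : operator :=
  @Operator (dom A) (fun x => A x - l *: x) (dom0 A) (@domP A)
    (@sub_scalar_linear A l).

Definition kernel (A : operator) : set V := [set x | dom A x /\ A x = 0].

Definition is_eigenvalue (A : operator) (l : K) : Prop :=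
  exists x : V, [/\ dom A x, x != 0 & A x = l *: x].

Definition point_spectrum (A : operator) : set K :=
  [set l | ~ set_inj (dom A) (sub_scalar A l)].

Definition has_dim (S : set V) (n : nat) : Prop :=
  exists e : 'I_n -> V,
    (forall c : 'I_n -> K, \sum_i c i *: e i = 0 -> forall i, c i = 0) /\
    S = range (fun c : 'I_n -> K => \sum_i c i *: e i).

Definition periodic_point (A : operator) : set V :=
  [set x | exists N : nat,
     [/\ (0 < N)%N, dom (pow_operator A N) x & pow_operator A N x = x]].

End Operators.

Section Chaos.
Variables (K : numFieldType) (V : normedModType K).

Definition unbounded (A : operator V) : Prop :=
  ~ exists M : K, forall x, dom A x -> `|A x| <= M * `|x|.

Definition hypercyclic_vector (A : operator V) (x : V) : Prop :=
  [/\ x != 0, forall n, dom (pow_operator A n) x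
    & dense (range (fun n => pow_operator A n x))].

Definition hypercyclic (A : operator V) : Prop :=
  exists x, hypercyclic_vector A x.

Definition chaotic (A : operator V) : Prop :=
  hypercyclic A /\ dense (periodic_point A).

End Chaos.

(* Sequences are indexed from 0: [x k] is the entry x_(k+1). *)
Section SequenceSpace.
Variable K : numFieldType.
Implicit Types x y : nat -> K.

Definition ratio x (k : nat) : K := x k / k.+1%:R.

Definition increment x (k : nat) : K := ratio x k.+1 - ratio x k.

Definition bv_seq : {pred nat -> K} :=
  [pred x | `[< cvgn [normed series (increment x)] /\
                ratio x @ \oo --> (0 : K) >]].

Definition bv_norm x : K := limn [normed series (increment x)].

Definition weighted_shift (w : K) x (k : nat) : K := w ^+ k.+1 * x k.+1.

Lemma ratioP (a : K) x y k :
  ratio (a *: x + y) k = a * ratio x k + ratio y k.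
Proof. by rewrite /ratio /= mulrDl mulrA. Qed.

Lemma incrementP (a : K) x y k :
  increment (a *: x + y) k = a * increment x k + increment y k.
Proof. by rewrite /increment !ratioP mulrBr opprD addrACA. Qed.

Lemma weighted_shiftP (w a : K) x y :
  weighted_shift w (a *: x + y) = a *: weighted_shift w x + weighted_shift w y.
Proof.
by apply/funext => k; rewrite /weighted_shift /= mulrDr mulrCA.
Qed.

End SequenceSpace.

Arguments bv_seq : clear implicits.

Lemma cvg_ge0 (K : numFieldType) (u : nat -> K) (l : K) :
  (\forall n \near \oo, 0 <= u n) -> u @ \oo --> l -> 0 <= l.
Proof.
move=> u0 ul; suff -> : l = `|l| by exact: normr_ge0.
have ul' : u @ \oo --> `|l|.
  apply: cvg_trans (cvg_norm ul); apply: near_eq_cvg.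
  by apply: filterS u0 => n un; rewrite ger0_norm.
exact: cvg_unique ul ul'.
Qed.

Lemma series_le_cvg_complex (R : realType) (u v : nat -> (R[i] : numFieldType)) :
  (forall n, 0 <= u n) -> (forall n, u n <= v n) ->
  cvgn (series v) -> cvgn (series u).
Proof.
move=> u0 uv /cvg_ex[l vl].
have ge0 (z : R[i]) : 0 <= z -> z = (complex.Re z)%:C%C.
  by move=> z0; rewrite RRe_real// ger0_real.
have sumRe (f : nat -> R[i]) n :
    complex.Re (\sum_(0 <= k < n) f k) = \sum_(0 <= k < n) complex.Re (f k).
  by rewrite raddf_sum.
have cv : cvgn (series (fun n => complex.Re (v n))).
  apply/cvg_ex; exists (complex.Re l); apply/cvgrPdist_lt => e e0.
  have e0' : 0 < e%:C%C :> R[i] by rewrite ltcR.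
  move/cvgrPdist_lt: vl => /(_ _ e0'); apply: filterS => n.
  rewrite /series /= -sumRe => h; rewrite -ltcR; apply: le_lt_trans h.
  by rewrite -raddfB normc_ge_Re.
have /cvg_ex[m um] : cvgn (series (fun n => complex.Re (u n))).
  apply: series_le_cvg cv => n.
  - by have := u0 n; rewrite lecE => /andP[].
  - by have := le_trans (u0 n) (uv n); rewrite lecE => /andP[].
  - by have := uv n; rewrite lecE => /andP[].
apply/cvg_ex; exists (m%:C)%C; apply/cvgrPdist_lt => e e0.
have eE : e = (complex.Re e)%:C%C by rewrite -ge0// ltW.
have e0' : 0 < complex.Re e by rewrite -ltcR -eE.
move/cvgrPdist_lt: um => /(_ _ e0'); apply: filterS => n h.
have -> : series u n = (series (fun n => complex.Re (u n)) n)%:C%C.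
  by rewrite /series /= raddf_sum; apply: eq_bigr => k _; exact: ge0.
rewrite -rmorphB /= eE normc_def /= expr0n/= addr0 sqrtr_sqr ltcR.
exact: h.
Qed.

Lemma series_le_cvg_scalar (R : realType) (s : scalars)
    (u v : nat -> scalar_field R s) :
  (forall n, 0 <= u n) -> (forall n, u n <= v n) ->
  cvgn (series v) -> cvgn (series u).
Proof.
case: s u v => u v u0 uv; last exact: series_le_cvg_complex.
by apply: series_le_cvg => // n; exact: le_trans (uv n).
Qed.

Section BvSpace.
Variables (R : realType) (s : scalars).
Let K : numFieldType := scalar_field R s.

Lemma bv_seqP (x : nat -> K) : reflect
  (cvgn [normed series (increment x)] /\ ratio x @ \oo --> (0 : K))
  (x \in bv_seq K).
Proof. exact: asboolP. Qed.

Lemma normed_increment_le (a : K) (x y : nat -> K) n :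
  `|increment (a *: x + y) n| <=
  `|a| * `|increment x n| + `|increment y n|.
Proof. by rewrite incrementP -normrM ler_normD. Qed.

Lemma cvg_normed_comb (a : K) (x y : nat -> K) :
  cvgn [normed series (increment x)] -> cvgn [normed series (increment y)] ->
  series (fun n => a * `|increment x n| + `|increment y n|) @ \oo -->
  a * bv_norm x + bv_norm y.
Proof.
move=> cx cy.
have -> : series (fun n => a * `|increment x n| + `|increment y n|) =
    (fun n => a * [normed series (increment x)] n +
              [normed series (increment y)] n).
  by apply/funext => n; rewrite /series /= big_split /= mulr_sumr.
by apply: cvgD => //; apply: cvgMr.
Qed.

Lemma bv_seq_submod : submod_closed (bv_seq K).
Proof.
have ratio0 : ratio (0 : nat -> K) = cst 0.
  by apply/funext => k; rewrite /ratio mul0r.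
split=> [|a x y /bv_seqP[sx x0] /bv_seqP[sy y0]]; apply/bv_seqP; split.
- rewrite (_ : [normed series _] = cst 0); first exact: is_cvg_cst.
  apply/funext => n /=; rewrite /series/= big1// => k _.
  by rewrite /increment ratio0 subrr normr0.
- by rewrite ratio0; exact: cvg_cst.
- apply: series_le_cvg_scalar (normed_increment_le a x y) _ => //.
  by apply/cvg_ex; eexists; exact: cvg_normed_comb.
- have -> : ratio (a *: x + y) = (fun k => a * ratio x k + ratio y k).
    by apply/funext => k; exact: ratioP.
  have -> : (0 : K) = a * 0 + 0 by rewrite mulr0 addr0.
  by apply: cvgD => //; apply: cvgMr.
Qed.

HB.instance Definition _ := GRing.isSubmodClosed.Build K (nat -> K) (bv_seq K)
  bv_seq_submod.

Record bv_space : Type := BvSpace {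
  bv_val :> nat -> K;
  bv_valP : bv_val \in bv_seq K
}.

HB.instance Definition _ := [isSub for bv_val].
HB.instance Definition _ := [Choice of bv_space by <:].
HB.instance Definition _ := [SubChoice_isSubLmodule of bv_space by <:].

Implicit Types x y : bv_space.

Lemma bv_valD x y : bv_val (x + y) = bv_val x + bv_val y.
Proof. by []. Qed.

Lemma bv_valZ (a : K) x : bv_val (a *: x) = a *: bv_val x.
Proof. by []. Qed.

Lemma bv_cvg x : cvgn [normed series (increment x)].
Proof. by have /bv_seqP[] := bv_valP x. Qed.
Arguments bv_cvg : clear implicits.

Lemma bv_normD x y : bv_norm (x + y) <= bv_norm x + bv_norm y :> K.
Proof.
have := @cvg_normed_comb 1 x y (bv_cvg x) (bv_cvg y); rewrite mul1r => h.
rewrite -subr_ge0; apply: cvg_ge0 (cvgB h (bv_cvg (x + y))).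
apply: nearW => n; rewrite subr_ge0 /series /=; apply: ler_sum => k _.
by have := normed_increment_le 1 x y k; rewrite scale1r normr1.
Qed.

Lemma bv_normZ (a : K) x : bv_norm (a *: x) = `|a| * bv_norm x.
Proof.
have e : [normed series (increment (a *: x))] =
    (fun n => `|a| * [normed series (increment x)] n).
  apply/funext => n; rewrite /series /= mulr_sumr; apply: eq_bigr => k _.
  by rewrite -normrM; congr `|_|; rewrite /increment /ratio /= -!mulrA mulrBr.
rewrite /bv_norm bv_valZ e; apply: cvg_lim => //; apply: cvgMr.
exact: bv_cvg.
Qed.

Lemma bv_norm_eq0 x : bv_norm x = 0 -> x = 0.
Proof.
move=> x0.
have inc0 k : increment x k = 0.
  apply/eqP; rewrite -normr_le0 -x0.
  apply: (@le_trans _ _ ([normed series (increment x)] k.+1)).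
    by rewrite /= /series /= big_nat_recr //= lerDr sumr_ge0.
  set S := [normed series _] => /=.
  rewrite -subr_ge0; apply: cvg_ge0 (cvgB (bv_cvg x) (cvg_cst (S k.+1))).
  exists k.+1 => // n /= kn; rewrite subr_ge0.
  by apply: nondecreasing_series => // m _ _; exact: normr_ge0.
have cst k : ratio x k = ratio x 0.
  by elim: k => // k <-; apply/eqP; rewrite -subr_eq0; apply/eqP/inc0.
have /bv_seqP[_ lim0] := bv_valP x.
have r0 : ratio x 0 = 0.
  suff : ratio x @ \oo --> ratio x 0 by move=> /cvg_unique; apply.
  by rewrite (_ : ratio x = fun=> ratio x 0); [exact: cvg_cst|exact/funext].
apply: val_inj; apply/funext => k; apply/eqP.
have /eqP := cst k; rewrite r0 mulf_eq0 invr_eq0 pnatr_eq0 orbF.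
by [].
Qed.

HB.instance Definition _ :=
  @Lmodule_isNormed.Build K bv_space (fun x => bv_norm x)
    bv_normD bv_normZ bv_norm_eq0.

End BvSpace.

Section WeightedShift.
Variables (R : realType) (s : scalars).
Let K : numFieldType := scalar_field R s.
Variable w : K.
Implicit Types x y : bv_space R s.

Definition shift_dom : set (bv_space R s) :=
  [set x | weighted_shift w x \in bv_seq K].

(* The default value 0 of [insubd] is only reached outside [shift_dom]. *)
Definition shift_op x : bv_space R s := insubd 0 (weighted_shift w x).

Lemma bv_val_shift_op x : shift_dom x ->
  bv_val (shift_op x) = weighted_shift w x.
Proof. by move=> Dx; rewrite -[LHS]/(val _) val_insubd Dx. Qed.

Lemma shift_dom0 : shift_dom 0.
Proof.
rewrite /shift_dom /= (_ : weighted_shift w _ = 0); first exact: rpred0.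
by apply/funext => k; rewrite /weighted_shift mulr0.
Qed.

Lemma shift_domP (a : K) x y :
  shift_dom x -> shift_dom y -> shift_dom (a *: x + y).
Proof.
move=> Dx Dy.
have -> : shift_dom (a *: x + y) =
    (weighted_shift w (a *: bv_val x + bv_val y) \in bv_seq K) by [].
by rewrite weighted_shiftP rpredD// rpredZ.
Qed.

Lemma shift_opP (a : K) x y : shift_dom x -> shift_dom y ->
  shift_op (a *: x + y) = a *: shift_op x + shift_op y.
Proof.
move=> Dx Dy; apply: val_inj => /=.
rewrite !bv_val_shift_op//; last exact: shift_domP.
exact: weighted_shiftP.
Qed.

Definition shift_operator : operator (bv_space R s) :=
  Operator shift_dom0 shift_domP shift_opP.

End WeightedShift.

(* Main.v *)
(* Let c_k be the product of the w^-(i+1) for i < k. Writing x_k = c_k v_k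
   turns the weighted shift into the plain backward shift of v, and the weights
   c_k decay faster than any geometric sequence. Moreover a sequence that is
   O(1/k) lies in the space, with norm controlled by the constant. So v = (l^k)
   gives an eigenvector for every l (whence also the unboundedness, since the
   eigenvalues are unbounded), periodic extensions of finite rational words give
   dense periodic points, and a v in which every such word is written infinitely
   often at positions b^j, followed by ever longer blocks of zeros, gives a
   hypercyclic vector; b = 2n makes these positions multiples of n, which treats
   the n-th power. *)
Require Import Defs.
From mathcomp Require Import all_boot all_order all_algebra.
From mathcomp Require Import complex.
From mathcomp Require Import all_classical all_reals.
From mathcomp Require Import topology normedtype sequences.
From mathcomp Require Import ring lra zify.

Import Order.TTheory GRing.Theory Num.Theory.
Import numFieldNormedType.Exports.

Local Open Scope classical_set_scope.
Local Open Scope ring_scope.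

Set Implicit Arguments.
Unset Strict Implicit.
Unset Printing Implicit Defensive.

(** * Inequalities for the harmonic sequence [1 / (n + 1)] *)

Section Harmonic.
Variable K : numFieldType.

Lemma harmonic_gt0 n : 0 < harmonic n :> K.
Proof. by rewrite invr_gt0 ltr0n. Qed.

Lemma harmonic_ge0 n : 0 <= harmonic n :> K.
Proof. exact/ltW/harmonic_gt0. Qed.

Lemma le_harmonic m n : (m <= n)%N -> harmonic n <= harmonic m :> K.
Proof. by move=> mn; rewrite lef_pV2 ?posrE ?ltr0n// ler_nat. Qed.

Lemma harmonic_le1 n : harmonic n <= 1 :> K.
Proof. by rewrite invf_le1 ?ltr0n// ler1n. Qed.

Lemma mul_harmonic n : n.+1%:R * harmonic n = 1 :> K.
Proof. by rewrite mulfV// pnatr_eq0. Qed.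

Lemma sum_harmonic_telescope n :
  \sum_(0 <= k < n) (harmonic k * harmonic k.+1) = 1 - harmonic n :> K.
Proof.
elim: n => [|n IHn]; first by rewrite big_nil /= invr1 subrr.
rewrite big_nat_recr//= IHn /=.
have n1 : n.+1%:R != 0 :> K by rewrite pnatr_eq0.
have n2 : n.+2%:R != 0 :> K by rewrite pnatr_eq0.
rewrite -natr1 in n2 *; move: n1 n2; move: n.+1%:R => a a0 a1.
by field; rewrite a0 a1.
Qed.

(** Squares are traded for terms of the telescoping sum above; this amounts to
    [n + 2 <= 2 (n + 1)]. *)
Lemma harmonic_sqr_le n :
  harmonic n ^+ 2 <= 2 * (harmonic n * harmonic n.+1) :> K.
Proof.
rewrite expr2 mulrCA ler_pM2l ?harmonic_gt0//.
rewrite ler_pdivlMr ?ltr0n//= mulrC ler_pdivrMr ?ltr0n// -natrM ler_nat.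
by lia.
Qed.

End Harmonic.

(** * Archimedean and density facts, uniformly over the real and complex fields *)

Section Scalars.
Variables (R : realType) (s : scalars).
Let K : numFieldType := scalar_field R s.

(** Over [R[i]] the hypothesis [0 < e] forces [e] to be real, so both cases reduce to the
    Archimedean property of [R]. *)
Lemma harmonic_lt (e : K) : 0 < e ->
  exists N, forall n, (N <= n)%N -> harmonic n < e.
Proof.
suff : 0 < e -> exists N, harmonic N < e.
  move=> h /h[N Ne]; exists N => n Nn.
  exact: le_lt_trans (@le_harmonic K _ _ Nn) Ne.
have realE (x : R) : 0 < x -> exists N, harmonic N < x.
  move=> x0; exists (Num.bound x^-1).
  rewrite invf_plt ?posrE ?ltr0n//; apply: lt_trans (archi_boundP _) _.
    by rewrite invr_ge0 ltW.
  by rewrite ltr_nat.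
have complexE (z : R[i]) : 0 < z -> exists N, harmonic N < z.
  move=> /[!ltcE] /andP[/= /eqP zi /realE[N Nz]]; exists N.
  have -> : N.+1%:R^-1 = (N.+1%:R^-1)%:C%C :> R[i].
    by rewrite fmorphV rmorph_nat.
  by rewrite ltcE /= -zi eqxx.
by rewrite /K in e *; case: s e.
Qed.

Lemma natr_ge (M : K) : 0 <= M -> exists N, forall n, (N <= n)%N -> M <= n%:R.
Proof.
move=> M0; have M1 : 0 < M + 1 by rewrite ltr_wpDl.
have [|N hN] := @harmonic_lt (M + 1)^-1; first by rewrite invr_gt0.
exists N => n /hN /=.
by rewrite ltf_pV2 ?posrE ?ltr0n// -natr1 ltrD2r => /ltW.
Qed.

(** Bernoulli's inequality gives linear growth, and the Archimedean property does the rest. *)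
Lemma expr_ge (a t : K) : 1 < a -> 0 <= t ->
  exists N, forall n, (N <= n)%N -> t <= a ^+ n.
Proof.
move=> a1 t0; have a0 : 0 < a - 1 by rewrite subr_gt0.
have bern n : n%:R * (a - 1) <= a ^+ n.
  elim: n => [|n IHn]; first by rewrite mul0r.
  rewrite exprS mulrSr mulrDl mul1r.
  have -> : a * a ^+ n = a ^+ n + (a - 1) * a ^+ n by ring.
  by rewrite lerD// ler_pMr// exprn_ege1// ltW.
have [|N hN] := @natr_ge (t / (a - 1)); first by rewrite divr_ge0// ltW.
exists N => n /hN; rewrite ler_pdivrMr// => /le_trans; apply; exact: bern.
Qed.

Lemma cvg_harmonic_scalar : harmonic @ \oo --> (0 : K).
Proof.
apply/cvgrPdist_lt => e /harmonic_lt[N hN]; exists N => // n /= /hN.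
by rewrite sub0r normrN ger0_norm ?harmonic_ge0.
Qed.

(** One countable index type serves both fields, so that finite words over it can be enumerated
    later. *)
Definition rational_scalar (t : rat * rat) : scalar_field R s :=
  match s with
  | RealScalars => ratr t.1
  | ComplexScalars => (ratr t.1 +i* ratr t.2)%C
  end.

Lemma rational_scalar_dense (z e : K) : 0 < e ->
  exists t, `|z - rational_scalar t| < e.
Proof.
have realE (x d : R) : 0 < d -> exists q : rat, `|x - ratr q| < d.
  move=> d0; have [|q] := @rat_in_itvoo R (x - d) (x + d); first by lra.
  by rewrite in_itv/= => /andP[? ?]; exists q; rewrite ltr_norml; lra.
have complexE (a d : R[i]) : 0 < d ->
    exists t : rat * rat, `|a - (ratr t.1 +i* ratr t.2)%C| < d.
  rewrite ltcE /= => /andP[/eqP di d0].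
  have d2 : 0 < complex.Re d / 2 by rewrite divr_gt0.
  have [p pe] := realE (complex.Re a) _ d2.
  have [q qe] := realE (complex.Im a) _ d2.
  exists (p, q); case: a pe qe => a b /= pe qe.
  have -> : ((a +i* b) - (ratr p +i* ratr q) =
      (a - ratr p)%:C + 'i * (b - ratr q)%:C)%C.
    by apply/eqP; rewrite eq_complex/=; apply/andP; split; apply/eqP; ring.
  apply: le_lt_trans (ler_normD _ _) _.
  rewrite normrM !normc_def /= !expr0n/= !expr1n !addr0 add0r sqrtr1 mul1r.
  rewrite !sqrtr_sqr ltcE/= di ?addr0 eqxx/= (splitr (complex.Re d)).
  by rewrite ltrD.
rewrite /rational_scalar /K in z e *; case: s z e => z e; last exact: complexE.
by move=> /(realE z)[q qe]; exists (q, 0).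
Qed.

End Scalars.

(** * Membership, norm bounds and truncation in the sequence space *)

Section Space.
Variables (R : realType) (s : scalars).
Let K : numFieldType := scalar_field R s.
Local Notation X := (bv_space R s).
Local Notation ratio := Defs.ratio.
Implicit Types (C : K) (y : nat -> K) (x z : X).

Definition harmonic_bounded C y := forall k, `|y k| <= C * harmonic k.

Lemma harmonic_bounded_ge0 C y : harmonic_bounded C y -> 0 <= C.
Proof.
move=> /(_ 0) hC; apply: le_trans (normr_ge0 _) (le_trans hC _).
by rewrite /= invr1 mulr1.
Qed.

Lemma harmonic_bounded_ratio C y k :
  harmonic_bounded C y -> `|ratio y k| <= C * harmonic k ^+ 2.
Proof.
move=> hC; rewrite /ratio normrM (ger0_norm (@harmonic_ge0 K k)) expr2 mulrA.
by rewrite ler_pM2r// harmonic_gt0.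
Qed.

Lemma harmonic_bounded_increment C y k : harmonic_bounded C y ->
  `|increment y k| <= 4 * C * (harmonic k * harmonic k.+1).
Proof.
move=> hC; have C0 := harmonic_bounded_ge0 hC.
apply: le_trans (ler_normB _ _) _.
have h1 := harmonic_bounded_ratio k hC.
have h2 : `|ratio y k.+1| <= C * harmonic k ^+ 2.
  apply: le_trans (harmonic_bounded_ratio k.+1 hC) _.
  apply: ler_wpM2l => //.
  by rewrite lerXn2r ?nnegrE ?harmonic_ge0// le_harmonic.
apply: le_trans (lerD h2 h1) _.
have -> : 4 * C * (harmonic k * harmonic k.+1) =
    C * (2 * (harmonic k * harmonic k.+1)) +
    C * (2 * (harmonic k * harmonic k.+1)).
  by ring.
by rewrite lerD// ler_wpM2l// harmonic_sqr_le.
Qed.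

Lemma cvg_telescope_scaled C :
  series (fun k => C * (harmonic k * harmonic k.+1)) @ \oo --> C.
Proof.
rewrite (_ : series _ = fun n => C * (1 - harmonic n)).
  rewrite -{2}[C]mulr1 -{2}[1]subr0; apply: cvgMr; apply: cvgB.
    exact: cvg_cst.
  exact: cvg_harmonic_scalar.
by apply/funext => n; rewrite /series/= -mulr_sumr sum_harmonic_telescope.
Qed.

Lemma harmonic_bounded_mem C y : harmonic_bounded C y -> y \in bv_seq K.
Proof.
move=> hC; apply/bv_seqP; split.
  have inc_le k := harmonic_bounded_increment k hC.
  apply: series_le_cvg_scalar inc_le _ => //.
  by apply/cvg_ex; eexists; exact: cvg_telescope_scaled.
apply/cvgrPdist_lt => e e0; have C0 := harmonic_bounded_ge0 hC.
(* [C] may vanish, so the threshold is divided by [C + 1]. *)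
have C1 : 0 < C + 1 by rewrite ltr_wpDl.
have [|N hN] := @harmonic_lt R s (e / (C + 1)); first by rewrite divr_gt0.
exists N => // n /= /hN; rewrite ltr_pdivlMr// => hn; rewrite sub0r normrN.
apply: le_lt_trans (harmonic_bounded_ratio n hC) _; apply: le_lt_trans hn.
rewrite expr2 mulrC -mulrA ler_pM2l ?harmonic_gt0//.
by rewrite -[leRHS]mul1r ler_pM ?harmonic_ge0 ?harmonic_le1// lerDl.
Qed.

Lemma harmonic_bounded_norm C x : harmonic_bounded C x -> `|x| <= 4 * C.
Proof.
move=> hC; rewrite -[`|x|]/(bv_norm x) -subr_ge0.
have bx : [normed series (increment x)] @ \oo --> bv_norm x by exact: bv_cvg.
apply: cvg_ge0 (cvgB (@cvg_telescope_scaled (4 * C)) bx).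
apply: nearW => n; rewrite subr_ge0 /series/=.
by apply: ler_sum => k _; exact: harmonic_bounded_increment.
Qed.

(** Zeroing the entries up to [n] kills the increments before index [n], turns the [n]-th into the
    jump [ratio x n.+1], and leaves the later ones as they were in [x]. *)
Lemma tail_norm x z n :
  (forall k, (k <= n)%N -> z k = 0) -> (forall k, (n < k)%N -> z k = x k) ->
  `|z| = `|ratio x n.+1| + (`|x| - [normed series (increment x)] n.+1).
Proof.
move=> z0 zx; rewrite -[`|z|]/(bv_norm z); apply: cvg_lim => //.
have E m : [normed series (increment z)] (m + n.+1)%N =
    `|ratio x n.+1| +
    ([normed series (increment x)] (m + n.+1)%N -
     [normed series (increment x)] n.+1).
  elim: m => [|m IHm].
    rewrite add0n subrr addr0 /= seriesS seriesEnat /= big1_seq ?addr0.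
      by rewrite /increment /ratio zx// z0// mul0r subr0.
    move=> k /=; rewrite mem_index_iota => /andP[_ kn].
    by rewrite /increment /ratio !z0 ?mul0r ?subrr ?normr0// ltnW.
  rewrite /= in IHm *; rewrite addSn !(seriesS _ (m + n.+1)) IHm.
  rewrite {1}/increment /Defs.ratio !zx; [|lia|lia].
  by rewrite addrCA; congr (_ + _); exact: addrA.
rewrite -(cvg_shiftn n.+1) (_ : (fun _ => _) = fun m => `|ratio x n.+1| +
    ([normed series (increment x)] (m + n.+1)%N -
     [normed series (increment x)] n.+1)); last first.
  by apply/funext => m; exact: E.
apply: cvgD; first exact: cvg_cst.
apply: cvgB; last exact: cvg_cst.
by rewrite (cvg_shiftn n.+1); exact: bv_cvg.
Qed.

Lemma tail_norm_lt x (e : K) : 0 < e -> exists n, forall z,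
  (forall k, (k <= n)%N -> z k = 0) -> (forall k, (n < k)%N -> z k = x k) ->
  `|z| < e.
Proof.
move=> e0; have e2 : 0 < e / 2 by rewrite divr_gt0.
have /bv_seqP[_ /cvgrPdist_lt/(_ _ e2)[N1 _ h1]] := bv_valP x.
have /cvgrPdist_lt/(_ _ e2)[N2 _ h2] := @bv_cvg R s x.
have l1 : (N1 <= (maxn N1 N2).+1)%N by rewrite leqW// leq_maxl.
have l2 : (N2 <= (maxn N1 N2).+1)%N by rewrite leqW// leq_maxr.
exists (maxn N1 N2) => z z0 zx; rewrite (tail_norm z0 zx) (splitr e) ltrD//.
  by have /= := h1 _ l1; rewrite sub0r normrN.
apply: le_lt_trans (h2 _ l2).
(* The order is partial over [R[i]], so a difference is below its modulus only once both terms are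
   known to be real. *)
apply: real_ler_norm; apply: rpredB; last first.
  by apply: ger0_real; rewrite /= seriesEnat; apply: sumr_ge0.
exact: (@normr_real _ _ x).
Qed.

Lemma bv_valB x z k : (x - z) k = x k - z k.
Proof. by []. Qed.

Lemma finite_sequences_dense x (e : K) : 0 < e -> exists n, forall z,
  (forall k, (k <= n)%N -> z k = x k) -> (forall k, (n < k)%N -> z k = 0) ->
  `|x - z| < e.
Proof.
move=> /(tail_norm_lt x)[n hn]; exists n => z zx z0; apply: hn => k hk.
  by rewrite bv_valB zx// subrr.
by rewrite bv_valB z0// subr0.
Qed.

End Space.

(** * Weighted coordinates and density of finite rational words *)

Section Weights.
Variables (R : realType) (s : scalars).
Let K : numFieldType := scalar_field R s.
Local Notation X := (bv_space R s).
Variable w : K.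
Hypothesis w_gt1 : 1 < `|w|.
Local Notation A := (shift_operator w).
Implicit Types (C M t e : K) (u v : nat -> K) (x : X).

Let w_neq0 : w != 0.
Proof. by rewrite -normr_gt0; apply: lt_trans w_gt1. Qed.

Definition weight (k : nat) : K := \prod_(i < k) (w ^+ i.+1)^-1.

Lemma weightS k : weight k.+1 = weight k / w ^+ k.+1.
Proof. by rewrite /weight big_ord_recr. Qed.

Lemma weight_neq0 k : weight k != 0.
Proof. by apply/prodf_neq0 => i _; rewrite invr_eq0 expf_neq0. Qed.

(** The quotient [u k.+1 / u k] is at most [8 t / |w|^(k+1)] for [t > 0], as [k + 2 <= 2 (k + 1)];
    hence [u] eventually decreases and the sum of its first values bounds it. Of the three harmonic
    factors, one gives membership in the space, one smallness of tails, and one absorbs linear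
    growth of the coordinates. *)
Lemma weight_decay t : 0 <= t ->
  exists2 C, 0 <= C & forall k, `|weight k| * t ^+ k <= C * harmonic k ^+ 3.
Proof.
move=> t0; pose u k := `|weight k| * t ^+ k * k.+1%:R ^+ 3.
have u0 k : 0 <= u k by rewrite !mulr_ge0// exprn_ge0.
have [|N hN] := @expr_ge R s `|w| (t * 8) w_gt1; first by rewrite mulr_ge0.
have uS k : (N <= k)%N -> u k.+1 <= u k.
  move=> /leqW/hN hk.
  have wk : 0 < `|w| ^+ k.+1 by rewrite exprn_gt0// normr_gt0.
  rewrite /u weightS normrM normfV normrX (exprS t) -!mulrA ler_wpM2l//.
  rewrite ler_pdivrMl//.
  rewrite mulrCA [leRHS]mulrCA ler_wpM2l ?exprn_ge0//.
  have h : k.+2%:R ^+ 3 <= 8 * k.+1%:R ^+ 3 :> K.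
    have -> : 8 = 2 ^+ 3 :> K by rewrite -natrX.
    by rewrite -exprMn -natrM lerXn2r ?nnegrE ?ler0n// ler_nat; lia.
  apply: le_trans (ler_wpM2l t0 h) _.
  by rewrite mulrA ler_wpM2r// exprn_ge0.
exists (\sum_(i < N.+1) u i); first exact: sumr_ge0.
move=> k; rewrite exprVn ler_pdivlMr ?exprn_gt0// -/(u k).
have small j : (j <= N)%N -> u j <= \sum_(i < N.+1) u i.
  rewrite -ltnS => jN; rewrite (bigD1 (Ordinal jN))//= lerDl.
  by apply: sumr_ge0.
elim: k => [|k IHk]; first exact: small.
by case: (leqP k.+1 N) => [/small//|]; rewrite ltnS => /uS/le_trans; apply.
Qed.

(** The default [0] is returned only for sequences outside the space, which never happens when [v]
    is [exp_bounded]. *)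
Definition weighted_vec v : X := insubd 0 (fun k => weight k * v k).

Lemma weighted_vecE C v k : harmonic_bounded C (fun k => weight k * v k) ->
  weighted_vec v k = weight k * v k.
Proof.
move=> /harmonic_bounded_mem h; rewrite /weighted_vec.
by rewrite -[bv_val _]/(val _) val_insubd h.
Qed.

Definition exp_bounded v := exists M t,
  [/\ 0 <= M, 0 <= t & forall k, `|v k| <= M * t ^+ k].

Lemma exp_bounded_shift m v : exp_bounded v ->
  exp_bounded (fun k => v (k + m)%N).
Proof.
move=> [M [t [M0 t0 hv]]]; exists (M * t ^+ m), t; split=> //.
  by rewrite mulr_ge0// exprn_ge0.
by move=> k; rewrite -mulrA -exprD addnC.
Qed.

Lemma exp_bounded_cst M v : (forall k, `|v k| <= M) -> exp_bounded v.
Proof.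
move=> hv; exists M, 1; split=> //; first exact: le_trans (hv 0).
by move=> k; rewrite expr1n mulr1.
Qed.

Lemma exp_bounded_weight v : exp_bounded v ->
  exists C, harmonic_bounded C (fun k => weight k * v k).
Proof.
move=> [M [t [M0 t0 hv]]]; have [C C0 hC] := weight_decay t0.
exists (M * C) => k; rewrite normrM.
apply: le_trans (ler_wpM2l (normr_ge0 _) (hv k)) _.
rewrite mulrCA -mulrA ler_wpM2l//; apply: le_trans (hC k) _.
rewrite ler_wpM2l// exprS ler_piMr ?harmonic_ge0//.
by rewrite exprn_ile1 ?harmonic_ge0 ?harmonic_le1.
Qed.

Lemma exp_bounded_vecE v : exp_bounded v ->
  bv_val (weighted_vec v) = (fun k => weight k * v k).
Proof.
by move=> /exp_bounded_weight[C hC]; apply/funext => k; exact: weighted_vecE hC.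
Qed.

(* In the coordinates [v], the operator is the unweighted backward shift. *)
Lemma shift_weighted_vec v : exp_bounded v ->
  dom A (weighted_vec v) /\ A (weighted_vec v) = weighted_vec (fun k => v k.+1).
Proof.
move=> hv; have hv1 : exp_bounded (fun k => v k.+1).
  have := exp_bounded_shift 1 hv.
  by congr exp_bounded; apply/funext => k; rewrite addn1.
have E : weighted_shift w (weighted_vec v) = weighted_vec (fun k => v k.+1).
  rewrite /weighted_shift !exp_bounded_vecE//; apply/funext => k.
  by rewrite weightS mulrA mulrCA mulfV ?mulr1// expf_neq0.
have D : dom A (weighted_vec v) by rewrite /= /shift_dom /= E bv_valP.
by split=> //; apply: val_inj; rewrite /= bv_val_shift_op.
Qed.

Lemma iter_shift_weighted_vec m v : exp_bounded v ->
  pow_dom A m (weighted_vec v) /\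
  iter m A (weighted_vec v) = weighted_vec (fun k => v (k + m)%N).
Proof.
move=> hv; elim: m => [|m [D E]].
  by split=> //=; congr weighted_vec; apply/funext => k; rewrite addn0.
have [D' E'] := shift_weighted_vec (exp_bounded_shift m hv).
split; first by split=> //; rewrite E.
rewrite iterS E E'.
by congr weighted_vec; apply/funext => k; rewrite addSnnS.
Qed.

Lemma weighted_vec_dist C u v : exp_bounded u -> exp_bounded v ->
  (forall k, `|weight k * (u k - v k)| <= C * harmonic k) ->
  `|weighted_vec u - weighted_vec v| <= 4 * C.
Proof.
move=> hu hv h; apply: harmonic_bounded_norm => k.
by rewrite bv_valB !exp_bounded_vecE// -mulrBr.
Qed.

Definition word (l : seq (rat * rat)) (k : nat) : K :=
  nth 0 (map (rational_scalar R s) l) k.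

Lemma word_bounded l : exists2 M, 0 <= M & forall k, `|word l k| <= M.
Proof.
rewrite /word; elim: l => [|a l [M M0 IH]].
  by exists 0 => // k; rewrite nth_nil normr0.
exists (`|rational_scalar R s a| + M) => [|[|k]/=]; first by rewrite addr_ge0.
  by rewrite lerDl.
by apply: le_trans (IH k) _; rewrite lerDr.
Qed.

Lemma exp_bounded_word l : exp_bounded (word l).
Proof. by have [M _ /exp_bounded_cst] := word_bounded l. Qed.

Lemma word_default l k : (size l <= k)%N -> word l k = 0.
Proof. by move=> lk; rewrite /word nth_default// size_map. Qed.

(** Half of [e] pays for truncating [x], the other half for rounding its finitely many remaining
    coordinates to rational scalars. *)
Lemma weighted_word_dense x e : 0 < e ->
  exists l, `|x - weighted_vec (word l)| < e.
Proof.
move=> e0; have e2 : 0 < e / 2 by rewrite divr_gt0.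
have [n hn] := finite_sequences_dense x e2.
have [C C0 hC] := weight_decay ler01.
have C1 : 0 < 8 * (C + 1) by rewrite mulr_gt0// ltr_wpDl.
(* Coordinate errors up to [d] give a vector of norm at most [4 * (d * (C + 1))], which is
   [e / 2]. *)
pose d := e / (8 * (C + 1)); have d0 : 0 < d by rewrite divr_gt0.
have [f hf] := choice (fun k => rational_scalar_dense (x k / weight k) d0).
pose l := mkseq f n.+1; exists l.
(* [r] is the rounding error: adding it to the word makes [z] below the exact truncation of [x]. *)
pose r k := if (k <= n)%N then x k / weight k - word l k else 0.
have rd k : `|r k| <= d.
  rewrite /r; case: leqP => kn; last by rewrite normr0 ltW.
  by rewrite /word (nth_map (0, 0)) ?size_mkseq// nth_mkseq// ltW.
have br : exp_bounded r by exact: exp_bounded_cst rd.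
pose z := weighted_vec (word l) + weighted_vec r.
have zE k : z k = weight k * (word l k + r k).
  rewrite mulrDr /z -[LHS]/(weighted_vec (word l) k + weighted_vec r k).
  by rewrite !exp_bounded_vecE//; exact: exp_bounded_word.
have -> : x - weighted_vec (word l) = (x - z) + weighted_vec r.
  by rewrite /z opprD addrA subrK.
apply: le_lt_trans (ler_normD _ _) _; rewrite (splitr e) ltr_leD//.
  apply: hn => k kn; rewrite zE /r.
    by rewrite kn addrC subrK mulrCA mulfV ?mulr1// weight_neq0.
  by rewrite leqNgt kn/= addr0 word_default ?mulr0// size_mkseq.
have -> : e / 2 = 4 * (d * (C + 1)).
  have -> : d * (C + 1) = e / (4 * 2).
    by rewrite -natrM /d invfM mulrA divfK// gt_eqF// ltr_wpDl.
  by rewrite invfM mulrCA mulVKf ?pnatr_eq0.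
apply: harmonic_bounded_norm => k; rewrite exp_bounded_vecE// normrM.
rewrite -mulrA mulrC ler_pM//; have := hC k; rewrite expr1n mulr1 => /le_trans.
apply; rewrite ler_pM ?exprn_ge0 ?harmonic_ge0 ?lerDl//.
rewrite exprS ler_piMr ?harmonic_ge0//.
by rewrite exprn_ile1 ?harmonic_ge0 ?harmonic_le1.
Qed.

End Weights.

(** * Chaos of a power, expressed through iterates of the operator *)

Lemma iter_op0 (K : numFieldType) (V : lmodType K) (A : operator V) n :
  iter n A 0 = 0.
Proof.
have [_] := pow_dom_linear (-1) (pow_dom0 A n) (pow_dom0 A n).
by rewrite scaleN1r addNr scaleN1r addNr.
Qed.

Section Powers.
Variables (K : numFieldType) (V : normedModType K) (A : operator V).

Lemma dense_norm (S : set V) :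
  (forall u (e : K), 0 < e -> exists2 v, S v & `|u - v| < e) -> dense S.
Proof.
move=> hS O [u Ou] oO.
have /nbhs_ballP[e /= e0 eO] : nbhs u O by exact: open_nbhs_nbhs.
have [v Sv ve] := hS u e e0; exists v; split=> //.
by apply: eO; rewrite -ball_normE.
Qed.

Lemma pow_dom_iter m n x : pow_dom A (m + n) x -> pow_dom A n (iter m A x).
Proof.
elim: n => [//|n IHn]; rewrite addnS => -[/IHn D D'].
by split=> //; rewrite -iterD addnC.
Qed.

Lemma pow_dom_pow_operator n m x : (forall k, pow_dom A k x) ->
  pow_dom (pow_operator A n) m x.
Proof.
move=> Dx; elim: m => //= m D; split=> //.
by rewrite -iterM; apply: pow_dom_iter.
Qed.

(** The [m]-th iterate of the [n]-th power is the [(m * n)]-th iterate of [A], so it suffices to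
    follow orbits of [A] along multiples of [n]. *)
Lemma chaotic_pow_operator n :
  (exists x, [/\ forall k, pow_dom A k x, x != 0 &
     forall y (e : K), 0 < e -> exists m, `|y - iter (m * n) A x| < e]) ->
  (forall y (e : K), 0 < e -> exists x, [/\ forall k, pow_dom A k x,
     exists2 N, (0 < N)%N & iter (N * n) A x = x & `|y - x| < e]) ->
  chaotic (pow_operator A n).
Proof.
move=> [x [Dx x0 orbit]] per; split.
  exists x; split=> // [m|]; first exact: pow_dom_pow_operator.
  apply: dense_norm => y e /(orbit y)[m ym].
  by exists (iter (m * n) A x) => //; exists m => //=; rewrite iterM.
apply: dense_norm => y e /(per y)[z [Dz [N N0 zN] yz]]; exists z => //.
by exists N; split=> //=; [exact: pow_dom_pow_operator | rewrite -iterM].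
Qed.

(** The two operators act identically by computation; only their domains differ in form, by a
    trivial conjunct. *)
Lemma chaotic_pow_operator1 : chaotic (pow_operator A 1) -> chaotic A.
Proof.
have sub m x : pow_dom (pow_operator A 1) m x -> pow_dom A m x.
  by elim: m => //= m IHm [/IHm D [_ D']].
move=> [[x [x0 Dx orbit]] per]; split.
  by exists x; split=> [//|m|]; [exact/sub/Dx | exact: orbit].
move=> O On Oo; have [y [Oy [N [N0 Dy Ny]]]] := per O On Oo.
by exists y; split=> //; exists N; split=> //; exact: sub Dy.
Qed.

End Powers.

(** * Eigenvectors of the shift *)

Section Chaos.
Variables (R : realType) (s : scalars).
Let K : numFieldType := scalar_field R s.
Local Notation X := (bv_space R s).
Variable w : K.
Hypothesis w_gt1 : 1 < `|w|.
Local Notation A := (shift_operator w).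
Local Notation vec := (weighted_vec w).
Implicit Types (l e : K) (x y : X).

Lemma exp_bounded_expr l : exp_bounded (fun k => l ^+ k).
Proof.
by exists 1, `|l|; split=> // k; rewrite normrX mul1r.
Qed.

Definition eigenvec l : X := vec (fun k => l ^+ k).

Lemma eigenvecE l k : eigenvec l k = weight w k * l ^+ k.
Proof. by rewrite exp_bounded_vecE//; exact: exp_bounded_expr. Qed.

Lemma eigenvec_neq0 l : eigenvec l != 0.
Proof.
apply/eqP => /(congr1 (fun x : X => x 0%N)); rewrite eigenvecE /= expr0 mulr1.
by move/eqP; apply/negP; exact: weight_neq0.
Qed.

Lemma shift_eigenvec l : dom A (eigenvec l) /\ A (eigenvec l) = l *: eigenvec l.
Proof.
have [D E] := shift_weighted_vec w_gt1 (exp_bounded_expr l); split=> //.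
rewrite E; apply: val_inj; apply/funext => k.
rewrite -[LHS]/(bv_val _ k) -[RHS]/(l * eigenvec l k) eigenvecE.
rewrite exp_bounded_vecE// ?exprS 1?mulrCA//.
by have := exp_bounded_shift 1 (exp_bounded_expr l);
  congr exp_bounded; apply/funext => j; rewrite addn1.
Qed.

(** The eigenvalue equation is a first-order recurrence with nonzero leading coefficient, so entry 0
    determines [x]; the scalar is [x 0] because [weight w 0 = 1]. *)
Lemma shift_eigen_unique l x :
  dom A x -> A x = l *: x -> x = x 0%N *: eigenvec l.
Proof.
move=> Dx Ax; have rec k : w ^+ k.+1 * x k.+1 = l * x k.
  have /(congr1 (fun z : X => z k)) := Ax.
  by rewrite [A x k](congr1 (fun f => f k) (bv_val_shift_op Dx)).
apply: val_inj; apply/funext => k.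
rewrite -[LHS]/(x k) -[RHS]/(x 0%N * eigenvec l k) eigenvecE.
elim: k => [|k IHk]; first by rewrite /weight big_ord0 expr0 !mulr1.
have wk : w ^+ k.+1 != 0.
  by rewrite expf_neq0// -normr_gt0; apply: lt_trans w_gt1.
apply: (mulfI wk); rewrite rec IHk weightS (exprS l) mulrCA [RHS]mulrCA.
by congr (_ * _); rewrite mulrCA [RHS]mulrA (mulrCA (w ^+ _)) mulfV// mulr1.
Qed.

Lemma eigenspace_dim1 l : has_dim (kernel (sub_scalar A l)) 1.
Proof.
exists (fun=> eigenvec l); split.
  move=> c; rewrite big_ord1 => /eqP.
  rewrite scaler_eq0 (negPf (eigenvec_neq0 l)).
  by rewrite orbF => /eqP c0 i; rewrite (ord1 i).
have [De Ee] := shift_eigenvec l.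
apply/seteqP; split=> [x [Dx /= /eqP]|_ [c _ <-]].
  rewrite subr_eq0 => /eqP Ax; exists (fun=> x 0%N) => //.
  by rewrite big_ord1 -(shift_eigen_unique Dx Ax).
rewrite big_ord1 -[_ *: _]addr0; split; first exact: domP (dom0 A).
have S0 : sub_scalar A l 0 = 0 := iter_op0 (sub_scalar A l) 1.
have Se : sub_scalar A l (eigenvec l) = 0.
  by rewrite -[LHS]/(A _ - _ *: _) Ee subrr.
by rewrite opP ?Se ?S0 ?scaler0 ?addr0//; exact: dom0 A.
Qed.

Lemma unbounded_shift : unbounded A.
Proof.
move=> [M hM]; have le l : `|l| <= M.
  have [D E] := shift_eigenvec l; have := hM _ D.
  by rewrite E normrZ ler_pM2r// normr_gt0 eigenvec_neq0.
have M0 : 0 <= M by rewrite -(normr0 K) le.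
have := le (M + 1); rewrite ger0_norm ?addr_ge0// gerDl.
by rewrite ler10.
Qed.

(** * Density of periodic points *)

Lemma periodic_vec_dense n y e : (0 < n)%N -> 0 < e ->
  exists x, [/\ forall k, pow_dom A k x,
     exists2 N, (0 < N)%N & iter (N * n) A x = x & `|y - x| < e].
Proof.
move=> n0 e0; have e2 : 0 < e / 2 by rewrite divr_gt0.
have [a ya] := weighted_word_dense w_gt1 y e2.
have [M M0 hM] := word_bounded R s a.
have [C C0 hC] := weight_decay w_gt1 ler01.
have B0 : 0 < 4 * (M * C + 1) by rewrite mulr_gt0// ltr_wpDl// mulr_ge0.
have [|N0 hN0] := @harmonic_lt R s (e / 2 / (4 * (M * C + 1))).
  by rewrite divr_gt0.
(* The period [L] exceeds the length of [a], so the periodic extension agrees with the word below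
   [L], and it is large enough to make the difference beyond [L] small. *)
pose N := (N0 + size a).+1; pose L := (N * n)%N.
have NL : (N <= L)%N by rewrite leq_pmulr.
pose v k := word R s a (k %% L).
have bv : exp_bounded v by apply: exp_bounded_cst => k; exact: hM.
exists (vec v); split=> [k||].
- by have [] := iter_shift_weighted_vec w_gt1 k bv.
- exists N => //; have [_ ->] := iter_shift_weighted_vec w_gt1 L bv.
  by congr weighted_vec; apply/funext => k; rewrite /v modnDr.
rewrite (splitr e); apply: le_lt_trans (ler_distD (vec (word R s a)) _ _) _.
apply: ltrD => //; have hL : harmonic L < e / 2 / (4 * (M * C + 1)).
  by apply: hN0; lia.
apply: (@le_lt_trans _ _ (4 * (M * C * harmonic L))).
  apply: weighted_vec_dist => // [|k]; first exact: exp_bounded_word.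
  case: (ltnP k L) => kL.
    rewrite /v modn_small// subrr mulr0 normr0.
    by rewrite !mulr_ge0 ?harmonic_ge0.
  rewrite word_default; last by lia.
  rewrite sub0r mulrN normrN normrM.
  have := hC k; rewrite expr1n mulr1 => wk.
  apply: le_trans (ler_pM _ _ wk (hM _)) _ => //.
  (* Of the three harmonic factors at [k], one is kept, one is at most [harmonic L] since [L <= k],
     and one is at most 1. *)
  rewrite mulrC -!mulrA ler_wpM2l// ler_wpM2l// exprS mulrC.
  rewrite ler_wpM2r ?harmonic_ge0// exprS expr1.
  apply: le_trans (le_harmonic K kL).
  by rewrite ler_piMl ?harmonic_ge0 ?harmonic_le1.
move: hL; rewrite ltr_pdivlMr// mulrC => /(le_lt_trans _); apply.
by rewrite mulrA ler_wpM2r ?harmonic_ge0// ler_wpM2l// lerDl.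
Qed.

(** * Construction of a hypercyclic vector *)

(** The 2-adic valuation takes each value infinitely often, so every code recurs; numbers that code
    no word give the empty one. *)
Definition universal_word (j : nat) : nat -> K :=
  word R s (odflt [::] (unpickle (logn 2 j))).

(* Every word is the [j]-th one for infinitely many [j]; it is written from
   position [b ^ j] on. The truncation keeps [|v p| <= p]. *)
Definition universal_seq (b p : nat) : K :=
  let j := trunc_log b p in
  let a := universal_word j (p - b ^ j) in
  if `|a| <= p%:R then a else 0.

Lemma universal_seq_le b p : `|universal_seq b p| <= p%:R.
Proof. by rewrite /universal_seq; case: ifP => //; rewrite normr0. Qed.

(** Since [k + b ^ j < 2 b ^ j <= b ^ (j + 1)], the truncated logarithm recovers [j]. *)
Lemma universal_seqE b j k : (1 < b)%N -> (k < b ^ j)%N ->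
  `|universal_word j k| <= (k + b ^ j)%:R ->
  universal_seq b (k + b ^ j) = universal_word j k.
Proof.
move=> b1 kj; rewrite /universal_seq.
rewrite (trunc_log_eq (n := j)) ?addnK => [->//|//|].
by rewrite leq_addl/= expnS; nia.
Qed.

Lemma exp_bounded_universal b : exp_bounded (universal_seq b).
Proof.
exists 1, 2; split=> // k; apply: le_trans (universal_seq_le b k) _.
by rewrite mul1r -natrX ler_nat ltnW// ltn_expl.
Qed.

Lemma universal_word_often a N :
  exists2 j, (N <= j)%N & universal_word j = word R s a.
Proof.
(* The factor [3 ^ N] makes the index large without changing its 2-adic valuation. *)
exists (2 ^ pickle a * 3 ^ N)%N.
  apply: leq_trans (leq_pmull _ _); last by rewrite expn_gt0.
  by rewrite ltnW// ltn_expl.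
rewrite /universal_word lognM ?expn_gt0// pfactorK// lognX.
by rewrite (_ : logn 2 3 = 0)%N// muln0 addn0 pickleK.
Qed.

Lemma universal_orbit_dense b y e N : (1 < b)%N -> 0 < e ->
  exists2 j, (N <= j)%N & `|y - iter (b ^ j) A (vec (universal_seq b))| < e.
Proof.
move=> b1 e0; have e2 : 0 < e / 2 by rewrite divr_gt0.
have [a ya] := weighted_word_dense w_gt1 y e2.
have [M M0 hM] := word_bounded R s a; have [N1 hN1] := natr_ge M0.
have [C C0 hC] := weight_decay w_gt1 ler01.
have B0 : 0 < 4 * (2 * C + 1) by rewrite mulr_gt0// ltr_wpDl// mulr_ge0.
have [|N2 hN2] := @harmonic_lt R s (e / 2 / (4 * (2 * C + 1))).
  by rewrite divr_gt0.
(* [N1] keeps the truncation from acting, [N2] makes the tail small, and [size a] makes the word fit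
   into its block. *)
have [j Nj ja] := universal_word_often a (N + N1 + N2 + size a).
exists j; first by lia.
have jb : (j <= b ^ j)%N by rewrite ltnW// ltn_expl.
have bv := exp_bounded_universal b.
have [_ ->] := iter_shift_weighted_vec w_gt1 (b ^ j) bv.
rewrite (splitr e); apply: le_lt_trans (ler_distD (vec (word R s a)) _ _) _.
apply: ltrD => //; have hj : harmonic j < e / 2 / (4 * (2 * C + 1)).
  by apply: hN2; lia.
apply: (@le_lt_trans _ _ (4 * (2 * C * harmonic j))).
  apply: weighted_vec_dist => // [||k]; first exact: exp_bounded_word.
    exact: exp_bounded_shift.
  case: (ltnP k (b ^ j)) => kj.
    rewrite universal_seqE// ja ?subrr ?mulr0 ?normr0.
      by rewrite !mulr_ge0 ?harmonic_ge0.
    by apply: le_trans (hM k) (hN1 _ _); lia.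
  rewrite word_default; last by lia.
  rewrite sub0r mulrN normrN normrM.
  have := hC k; rewrite expr1n mulr1 => wk.
  have vk : `|universal_seq b (k + b ^ j)| <= 2 * k.+1%:R.
    by apply: le_trans (universal_seq_le _ _) _; rewrite -natrM ler_nat; lia.
  apply: le_trans (ler_pM _ _ wk vk) _ => //.
  (* The growth [k + 1] cancels one of the three harmonic factors; another is at most [harmonic j],
     because [j <= b ^ j <= k]. *)
  rewrite mulrC -!mulrA ler_wpM2l// mulrCA ler_wpM2l//.
  rewrite exprS mulrA mul_harmonic mul1r expr2 ler_wpM2r ?harmonic_ge0//.
  by rewrite le_harmonic// (leq_trans jb).
move: hj; rewrite ltr_pdivlMr// mulrC => /(le_lt_trans _); apply.
by rewrite mulrA ler_wpM2r ?harmonic_ge0// ler_wpM2l// lerDl.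
Qed.

Lemma hypercyclic_shift n : (0 < n)%N ->
  exists x, [/\ forall k, pow_dom A k x, x != 0 &
     forall y e, 0 < e -> exists m, `|y - iter (m * n) A x| < e].
Proof.
move=> n0; pose b := (2 * n)%N; have b1 : (1 < b)%N by rewrite /b; lia.
have Dv k := (iter_shift_weighted_vec w_gt1 k (exp_bounded_universal b)).1.
exists (vec (universal_seq b)); split=> // [|y e e0]; last first.
  (* Requiring a positive exponent makes the time [b ^ j.+1 = b ^ j * 2 * n] a multiple of [n]. *)
  have [[//|j] _ hj] := universal_orbit_dense y 1 b1 e0.
  by exists (b ^ j * 2)%N; rewrite -mulnA -/b -expnSr.
(* The orbit of 0 stays at 0, so it cannot come closer to a nonzero vector than the norm of that
   vector. *)
apply/eqP => v0; have e0 : 0 < `|eigenvec 1| by rewrite normr_gt0 eigenvec_neq0.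
have [j _] := universal_orbit_dense (eigenvec 1) 0 b1 e0.
by rewrite v0 iter_op0 subr0 ltxx.
Qed.

(** * Chaos of all powers, and the point spectrum *)

Lemma chaotic_pow_shift n : (0 < n)%N -> chaotic (pow_operator A n).
Proof.
move=> n0; apply: chaotic_pow_operator; first exact: hypercyclic_shift.
by move=> y e; exact: periodic_vec_dense.
Qed.

Lemma point_spectrum_shift : point_spectrum A = [set: K].
Proof.
apply/seteqP; split=> // l _ /= inj; have [D E] := shift_eigenvec l.
have /eqP := eigenvec_neq0 l; apply; apply: inj; rewrite ?inE//.
  exact: dom0.
have -> : sub_scalar A l 0 = 0 := iter_op0 (sub_scalar A l) 1.
by rewrite -[LHS]/(A _ - _ *: _) E subrr.
Qed.

End Chaos.

Theorem theorem5p1 (R : realType) (s : scalars) (w : scalar_field R s)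
    (hw : 1 < `|w|) :
  unbounded (shift_operator w) /\
  chaotic (shift_operator w) /\
  (forall n : nat, (0 < n)%N -> chaotic (pow_operator (shift_operator w) n)) /\
  (forall l : scalar_field R s,
     is_eigenvalue (shift_operator w) l /\
     has_dim (kernel (sub_scalar (shift_operator w) l)) 1) /\
  (s = ComplexScalars -> point_spectrum (shift_operator w) = [set: scalar_field R s]).
Proof.
split; first exact: unbounded_shift.
split; first exact/chaotic_pow_operator1/chaotic_pow_shift.
split; first by move=> n; exact: chaotic_pow_shift.
split=> [l|_]; last exact: point_spectrum_shift.
split; last exact: eigenspace_dim1.
have [D E] := shift_eigenvec hw l.
by exists (eigenvec w l); rewrite eigenvec_neq0.
Qed.
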